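(* Let $C$ and $D$ be nonempty convex sets (in real vector spaces) and let $\phi:C\to D$ be a surjective affine map. Then the subspace $\{h\circ\phi : h\in\mathcal{A}_{\mathrm{b}}(D)\}$ of $\mathcal{A}_{\mathrm{b}}(C)$ is proximinal in $\mathcal{A}_{\mathrm{b}}(C)$; that is, for every $f\in\mathcal{A}_{\mathrm{b}}(C)$ there exists $h_0\in\mathcal{A}_{\mathrm{b}}(D)$ such that $$\|f-h_0\circ\phi\|=\inf\{\|f-h\circ\phi\| : h\in\mathcal{A}_{\mathrm{b}}(D)\}.$$
   Context: For a nonempty convex set $K$, $\mathcal{A}_{\mathrm{b}}(K)$ denotes the normed space of all bounded affine real-valued functions on $K$ with the supremum norm $\|g\|=\sup_{x\in K}|g(x)|$. A map $g$ between convex sets (or from a convex set to $\mathbb{R}$) is affine if $g(tx+(1-t)x')=t\,g(x)+(1-t)\,g(x')$ for all $x,x'$ in its domain and all $t\in[0,1]$. A surjective affine map $\phi:C\to D$ induces a linear isometric embedding $\tilde\phi:\mathcal{A}_{\mathrm{b}}(D)\to\mathcal{A}_{\mathrm{b}}(C)$, $\tilde\phi(h)=h\circ\phi$, by which $\mathcal{A}_{\mathrm{b}}(D)$ is identified with a subspace of $\mathcal{A}_{\mathrm{b}}(C)$. A subset $T$ of a metric space $(S,d)$ is proximinal in $S$ if for every $s\in S$ there exists $t_s\in T$ with $d(s,t_s)=\inf_{t\in T}d(s,t)$. *)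

(* Defs.v *)
From HB Require Import structures.
From mathcomp Require Import all_boot all_order all_algebra.
From mathcomp Require Import interval_inference.
From mathcomp Require Import mathcomp_extra boolp classical_sets functions.
From mathcomp Require Import reals topology normedtype convex.

Set Implicit Arguments.
Unset Strict Implicit.
Unset Printing Implicit Defensive.

Import Order.TTheory GRing.Theory Num.Theory.
Import numFieldNormedType.Exports.

Local Open Scope classical_set_scope.
Local Open Scope ring_scope.
Local Open Scope convex_scope.

Section convex_sub.
Context {R : numDomainType} {E : lmodType R} {C : set (convex_lmodType E)}.

(* A convex subset of a vector space as a type. It depends on the proof of
   convexity because that proof provides the operator of its convex space
   structure. *)
Definition convex_sub (cC : convex_set C) : Type := set_type C.

Context (cC : convex_set C).

HB.instance Definition _ := Choice.copy (convex_sub cC) (set_type C).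

Let sconv (p : {i01 R}) (x y : convex_sub cC) : convex_sub cC :=
  exist _ (val x <| p |> val y) (cC p (valP x) (valP y)).

Let sconv1 x y : sconv 1%:i01 x y = x.
Proof. by apply: val_inj; rewrite /= conv1. Qed.

Let sconvmm p x : sconv p x x = x.
Proof. by apply: val_inj; rewrite /= convmm. Qed.

Let sconvC p x y : sconv p x y = sconv (1 - p%:inum)%:i01 y x.
Proof. by apply: val_inj; rewrite /= convC. Qed.

Let sconvA : convex_quasi_associative sconv.
Proof.
by move=> p q r s a b c prs spq; apply: val_inj; exact: convA.
Qed.

HB.instance Definition _ :=
  isConvexSpace.Build R (convex_sub cC) sconv1 sconvmm sconvC sconvA.

Lemma val_conv (t : {i01 R}) (x y : convex_sub cC) :
  (val (x <| t |> y) : E) =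
  t%:num *: (val x : E) + (1 - t%:num) *: (val y : E).
Proof. by []. Qed.

End convex_sub.

Definition affine (R : numDomainType) (A B : convType R) (f : A -> B) : Prop :=
  forall (t : {i01 R}) (x y : A), f (x <| t |> y) = f x <| t |> f y.

Section bounded_affine_functions.
Context {R : realType} (K : convType R).

Definition bounded_affine : {pred K -> R^o} :=
  mem [set f : K -> R^o | affine f /\ bounded_fun f].

Record Ab := MkAb { Ab_fun :> K -> R^o ; _ : Ab_fun \in bounded_affine }.

HB.instance Definition _ := [isSub for Ab_fun].
HB.instance Definition _ := [Choice of Ab by <:].

Lemma Ab_affine (f : Ab) : affine f.
Proof. by case: f => f /= /set_mem[]. Qed.

Lemma bounded_funP (f : K -> R^o) :
  bounded_fun f <-> exists M, forall x, `|f x| <= M.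
Proof.
split=> [[M [_ Mf]]|[M Mf]].
  by exists (M + 1) => x; apply: Mf => //; rewrite ltrDl.
exists M; split; first exact: num_real.
by move=> y /ltW My x _ /=; exact: le_trans (Mf x) My.
Qed.

Lemma Ab_bounded (f : Ab) : exists M, forall x, `|f x| <= M.
Proof. by case: f => f /= /set_mem[_ /bounded_funP]. Qed.

Let bounded_affine_submod : submod_closed bounded_affine.
Proof.
split.
  apply: mem_set; split; last by apply/bounded_funP; exists 0 => x; rewrite normr0.
  by move=> t x y; rewrite convmm.
move=> a f g /set_mem[af /bounded_funP[M Mf]] /set_mem[ag /bounded_funP[N Ng]].
apply: mem_set; split; last first.
  apply/bounded_funP; exists (`|a| * M + N) => x.
  rewrite (le_trans (ler_normD _ _))// lerD// normrM.
  by rewrite ler_wpM2l.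
move=> t x y.
have -> z : (a *: f + g) z = a * f z + g z by [].
rewrite af ag !convRE !mulrDr !(mulrCA a) -!addrA; congr (_ + _).
by rewrite addrCA.
Qed.

HB.instance Definition _ :=
  GRing.isSubmodClosed.Build R (K -> R^o) bounded_affine bounded_affine_submod.
HB.instance Definition _ := [SubChoice_isSubLmodule of Ab by <:].

(* If K is empty this supremum is the junk value 0, which is still a norm since
   Ab then has a single element. *)
Definition Ab_norm (f : Ab) : R := sup (range (fun x => `|f x|)).

Lemma Ab_norm_ub (f : Ab) x : `|f x| <= Ab_norm f.
Proof.
apply: sup_upper_bound; last by exists x.
split; first by exists `|f x|, x.
by have [M Mf] := Ab_bounded f; exists M => _ [y _ <-].
Qed.

Lemma Ab_norm_le (f : Ab) M : 0 <= M -> (forall x, `|f x| <= M) ->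
  Ab_norm f <= M.
Proof.
move=> M0 Mf; rewrite /Ab_norm.
have [->|/set0P r0] := eqVneq (range (fun x => `|f x|)) set0.
  by rewrite sup0.
by apply: ge_sup => // _ [x _ <-].
Qed.

Lemma Ab_norm_ge0 (f : Ab) : 0 <= Ab_norm f.
Proof.
rewrite /Ab_norm.
have [->|/set0P[_ [x _ _]]] := eqVneq (range (fun x => `|f x|)) set0.
  by rewrite sup0.
exact: le_trans (normr_ge0 (f x)) (Ab_norm_ub f x).
Qed.

Let ler_Ab_normD (f g : Ab) : Ab_norm (f + g) <= Ab_norm f + Ab_norm g.
Proof.
apply: Ab_norm_le => [|x]; first by rewrite addr_ge0 ?Ab_norm_ge0.
by rewrite (le_trans (ler_normD _ _))// lerD ?Ab_norm_ub.
Qed.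

Let Ab_norm_eq0 (f : Ab) : Ab_norm f = 0 -> f = 0.
Proof.
move=> f0; apply: val_inj; apply/funext => x; apply/eqP.
by rewrite -normr_le0 -f0; exact: Ab_norm_ub.
Qed.

Let Ab_normZ_le (a : R) (f : Ab) : Ab_norm (a *: f) <= `|a| * Ab_norm f.
Proof.
apply: Ab_norm_le => [|x]; first by rewrite mulr_ge0 ?Ab_norm_ge0.
have -> : (a *: f) x = a * f x by [].
by rewrite normrM ler_wpM2l// Ab_norm_ub.
Qed.

Let Ab_normZ (a : R) (f : Ab) : Ab_norm (a *: f) = `|a| * Ab_norm f.
Proof.
apply/eqP; rewrite eq_le Ab_normZ_le /=.
have [->|a0] := eqVneq a 0; first by rewrite normr0 mul0r Ab_norm_ge0.
rewrite -ler_pdivlMl ?normr_gt0// -normfV.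
by have := Ab_normZ_le a^-1 (a *: f); rewrite scalerA mulVf// scale1r.
Qed.

HB.instance Definition _ :=
  Lmodule_isNormed.Build R Ab ler_Ab_normD Ab_normZ Ab_norm_eq0.

Lemma Ab_normE (f : Ab) : `|f| = sup [set `|f x| | x in [set: K]].
Proof. by []. Qed.

Let Ab_dist (f g : Ab) : R := `|f - g|.

Let Ab_dist_ge0 f g : 0 <= Ab_dist f g.
Proof. exact: normr_ge0. Qed.

Let Ab_dist_positivity f g : Ab_dist f g = 0 -> f = g.
Proof. by move/normr0_eq0/eqP; rewrite subr_eq0 => /eqP. Qed.

Let Ab_ball_dist (f : Ab) d : ball f d = [set g | Ab_dist f g < d].
Proof. by rewrite -ball_normE. Qed.

HB.instance Definition _ := PseudoMetric_isMetric.Build R Ab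
  Ab_dist_ge0 Ab_dist_positivity Ab_ball_dist.

Lemma Ab_mdistE (f g : Ab) : mdist f g = `|f - g|.
Proof. by []. Qed.

End bounded_affine_functions.

Section pullback.
Context {R : realType} {A B : convType R} {phi : A -> B}.
Context (aphi : affine phi).

Let pullback_subproof (h : Ab B) : (h \o phi : A -> R^o) \in @bounded_affine R A.
Proof.
apply: mem_set; split; first by move=> t x y; rewrite /= aphi Ab_affine.
by apply/bounded_funP; have [M hM] := Ab_bounded h; exists M => x; exact: hM.
Qed.

Definition pullback (h : Ab B) : Ab A := MkAb (pullback_subproof h).

Lemma pullback_linear : linear pullback.
Proof. by move=> a f g; exact: val_inj. Qed.

Lemma pullback_isometry : range phi = [set: B] ->
  forall h, `|pullback h| = `|h|.
Proof.
move=> sphi h; rewrite !Ab_normE; congr sup.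
by rewrite -sphi image_comp.
Qed.

End pullback.

Definition proximinal (R : realType) (S : metricType R) (T : set S) : Prop :=
  forall s, exists2 t, T t & mdist s t = inf [set mdist s t' | t' in T].

Lemma proximinal_pullbackE (R : realType) (A B : convType R) (phi : A -> B)
    (aphi : affine phi) :
  proximinal (range (pullback aphi)) <->
  forall f : Ab A, exists h0 : Ab B,
    `|f - pullback aphi h0| =
    inf [set `|f - pullback aphi h| | h in [set: Ab B]].
Proof.
have E (f : Ab A) : [set mdist f t | t in range (pullback aphi)] =
    [set `|f - pullback aphi h| | h in [set: Ab B]] by rewrite image_comp.
split=> H f; have := H f; rewrite E.
  by move=> [_ [h0 _ <-]] <-; exists h0.
by move=> [h0 <-]; exists (pullback aphi h0) => //; exists h0.
Qed.

(* Main.v *)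
(** The weak-* compactness argument: a minimizing sequence [h_ n] in [Ab D] is
    bounded, because pulling back along a surjection preserves the norm. Its
    pointwise limit along a free ultrafilter on [nat] therefore exists; it is
    again affine and bounded, and it attains the infimum because the inequality
    [`|f x - h_ n (phi x)| <= d + n.+1^-1] passes to the limit at every [x]. *)

Require Import Defs.
From mathcomp Require Import all_boot all_order all_algebra.
From mathcomp Require Import interval_inference.
From mathcomp Require Import boolp classical_sets functions.
From mathcomp Require Import reals topology normedtype convex.
From mathcomp Require Import sequences.

Import Order.TTheory GRing.Theory Num.Theory.
Import numFieldNormedType.Exports.

Local Open Scope classical_set_scope.
Local Open Scope ring_scope.
Local Open Scope convex_scope.

(** If a proper filter [G] finer than the image contained some [A] outside the image, [F] would
    contain the preimage of the complement of [A], so [G] would contain two disjoint sets. *)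
Lemma fmap_ultra (T U : Type) (f : T -> U) (F : set_system T) :
  UltraFilter F -> UltraFilter (f @ F).
Proof.
move=> FU; have FF : ProperFilter F by exact: ultra_proper.
apply: Build_UltraFilter => G GF FG.
rewrite eqEsubset; split => // A GA.
have [//|FC] := in_ultra_setVsetC (f @^-1` A) FU.
have GC : G (~` A) by exact: FG.
have : G set0 by rewrite -(setICr A); exact: filterI.
by move/filter_not_empty.
Qed.

(** The image ultrafilter contains the compact segment from [- M] to [M], hence converges in it. *)
Lemma ultra_bounded_cvg (R : realType) (T : Type) (U : set_system T)
    (u : T -> R) (M : R) :
  UltraFilter U -> (forall i, `|u i| <= M) -> exists l : R, u @ U --> l.
Proof.
move=> UU uM; have UF : ProperFilter U by exact: ultra_proper.
have : compact `[- M, M] by exact: segment_compact.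
rewrite compact_ultra => /(_ _ (fmap_ultra _ _ u _ UU)) [|l [_ ul]]; last by exists l.
apply: (@filterS _ U _ setT) => [i _ /=|]; last exact: filterT.
by rewrite in_itv /= -ler_norml.
Qed.

(** Weak-* compactness of balls in pointwise form. A single ultrafilter gives limits at all points
    of [B] at once, which a subsequence may fail to do when [B] is uncountable. *)
Lemma bounded_affine_ultralimit (R : realType) (B : convType R) (T : Type)
    (U : set_system T) (h_ : T -> Ab B) (M : R) :
  UltraFilter U -> (forall i, `|h_ i| <= M) ->
  exists h : Ab B, forall y, (h_ i y : R) @[i --> U] --> (h y : R).
Proof.
move=> UU hM; have UF : ProperFilter U by exact: ultra_proper.
have hyM y i : `|h_ i y : R| <= M.
  by apply: le_trans (hM i); exact: Ab_norm_ub.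
have [l hl] := choice (fun y => ultra_bounded_cvg _ _ _ _ _ UU (hyM y)).
suff lB : (l : B -> R^o) \in @bounded_affine R B by exists (MkAb lB).
apply: mem_set; split=> [t x y|].
  rewrite convRE; apply: (cvg_unique _ (hl _)); first exact: Rhausdorff.
  have -> : (fun i => h_ i (x <| t |> y) : R) = fun i =>
      t%:num * (h_ i x : R) + unstable.onem t%:num * (h_ i y : R).
    by apply/funext => i; rewrite Ab_affine convRE.
  by apply: cvgD; apply: cvgMl_tmp; exact: hl.
apply/Defs.bounded_funP; exists M => y.
by apply: (cvgr_to_le (cvg_norm (hl y))); exact: nearW.
Qed.

Lemma proximinal_range_pullback (R : realType) (A B : convType R)
    (phi : A -> B) (aphi : affine phi) (sphi : range phi = [set: B]) :
  proximinal (range (pullback aphi)).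
Proof.
apply/proximinal_pullbackE => f.
set S := [set _ | _ in _]; set d := inf S.
have S0 : lbound S 0 by move=> _ [h _ <-]; exact: normr_ge0.
have infS : has_inf S by split; [exists `|f - pullback aphi 0|, 0|exists 0].
(* [Ab_norm_le], applied below with the bound [d], asks for a nonnegative bound. *)
have d0 : 0 <= d by apply: lb_le_inf => //; case: infS.
have hP (n : nat) : exists h : Ab B, `|f - pullback aphi h| <= d + harmonic n.
  have [_ [h _ <-] /ltW hd] := inf_adherent (harmonic_gt0 n) infS.
  by exists h.
have [h_ h_d] := choice hP.
(* Triangle inequality for [pullback aphi (h_ n)]; the 1 bounds [harmonic n], that is [n.+1^-1]. *)
have h_M n : `|h_ n| <= `|f| + (d + 1).
  rewrite -(pullback_isometry aphi sphi).
  have -> : pullback aphi (h_ n) = f - (f - pullback aphi (h_ n)).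
    by rewrite opprB addrC subrK.
  rewrite (le_trans (ler_normB _ _))// lerD2l (le_trans (h_d n))// lerD2l.
  by rewrite /= invf_le1 ?ltr0n// ler1n.
(* [U] refines the eventually filter, so [harmonic] still tends to 0 along [U]. *)
have [U [UU ooU]] := ultraFilterLemma eventually_filter.
have UF : ProperFilter U by exact: ultra_proper.
have [h hlim] := bounded_affine_ultralimit _ _ _ _ _ _ UU h_M.
exists h; apply/eqP; rewrite eq_le; apply/andP; split; last first.
  by apply: ge_inf; [case: infS|exists h].
(* The norm is a supremum of pointwise values, so pointwise convergence is enough to bound it. *)
apply: Ab_norm_le => // x.
have hx : `|(f x : R) - (h_ n (phi x) : R)| @[n --> U] -->
    `|(f x : R) - (h (phi x) : R)|.
  by apply: cvg_norm; apply: cvgB; [exact: cvg_cst|exact: hlim].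
have dU : d + harmonic n @[n --> U] --> d.
  have doo : d + harmonic n @[n --> \oo] --> d.
    by rewrite -[X in _ --> X]addr0; apply: cvgD (cvg_cst _) cvg_harmonic.
  by move=> P /doo; exact: ooU.
apply: (ler_cvg_to hx dU); apply: nearW => n.
by apply: le_trans (h_d n); exact: (Ab_norm_ub (f - pullback aphi (h_ n)) x).
Qed.

Theorem theorem2p1 (R : realType) (E F : lmodType R)
    (C : set (convex_lmodType E)) (D : set (convex_lmodType F))
    (cC : convex_set C) (cD : convex_set D)
    (C0 : C !=set0) (D0 : D !=set0)
    (phi : convex_sub cC -> convex_sub cD)
    (aphi : affine phi) (sphi : range phi = [set: convex_sub cD]) :
  proximinal (range (pullback aphi)).
Proof. exact: proximinal_range_pullback. Qed.
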